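(* Let $a,b,c,d$ be generic real parameters and $m,p$ complex numbers. The function $$\Phi_{m,p}(x,y)=\psi_m^{(b,\;2p,\;2a+d+2)}\!\Bigl(\tfrac{x}{x+y}\Bigr)\,\psi_p^{(c,\;d-b-c,\;2a+b+d+3)}(x+y)$$ satisfies $$C_{12}\Phi_{m,p}=\frac{4p^2-1}{4}\,\Phi_{m,p},\qquad C_{123}\Phi_{m,p}=\frac{4m^2-1}{4}\,\Phi_{m,p}.$$
   Context: Functions are considered on the open triangle $\{(x,y): x>0,\ y>0,\ x+y<1\}$. ''Generic'' means that the hypergeometric series below are well defined, i.e. neither $b+1$ nor $c+1$ is a non-positive integer. Special functions: with ${}_2F_1$ the Gauss hypergeometric function, $$\psi_m^{(\beta,\gamma,\delta)}(x)=x^{m-\frac12(\delta+1)}\,{}_2F_1\bigl(m+\tfrac12(\beta+\gamma+1),\,m+\tfrac12(\beta-\gamma+1);\,\beta+1;\,1-x\bigr),\quad 0<x<1.$$ Operators: with $[A,B]=AB-BA$, $\{A,B\}=AB+BA$, $X_1$ = multiplication by $x$, $X_3$ = multiplication by $1-x-y$, $$L_3=xy(\partial_x^2+\partial_y^2-2\partial_x\partial_y)+\bigl((a+1)y-(b+1)x\bigr)(\partial_x-\partial_y),$$ $$L=x(1-x)\partial_x^2+y(1-y)\partial_y^2-2xy\,\partial_x\partial_y+(a+1-(a+b+c+3)x)\partial_x+(b+1-(a+b+c+3)y)\partial_y,$$ $$C_{34}=-L_3+\tfrac{(a+b+1)^2-1}{4},\qquad C_{234}=-L+\tfrac{(a+b+c+2)^2-1}{4},$$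 $$C_{123}=\tfrac{a+d+2}{2}[X_1,C_{234}]-\tfrac12\{X_1,C_{234}\}-\tfrac{(a+d+2)^2-(d-b-c)^2}{4}X_1+\tfrac{a^2+(a+d+2)^2-2}{4},$$ $$C_{12}=-\tfrac{a+d+2}{2}[X_3,C_{234}]+\tfrac12\{X_3-1,C_{234}\}+\tfrac{(a+d+2)^2-(d-b-c)^2}{4}(X_3-1)+C_{34}+\tfrac{(a+d+2)^2-1}{4}.$$ *)

(* Defs.v *)
From Stdlib Require Import Reals Factorial.
From Coquelicot Require Import Coquelicot.

Open Scope R_scope.

(** * Special functions *)

(** Principal value of [x ^ s] for real [x > 0] and complex [s]; meaningless
    (as is [ln x]) for [x <= 0]. *)
Definition cpower (x : R) (s : C) : C :=
  (exp (Re s * ln x) * (cos (Im s * ln x), sin (Im s * ln x)))%C.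

Definition CSeries (u : nat -> C) : C :=
  (Series (fun n => Re (u n)), Series (fun n => Im (u n))).

(** Rising factorial [z (z + 1) ... (z + n - 1)]. *)
Fixpoint pochhammer (z : C) (n : nat) : C :=
  match n with
  | O => 1%C
  | S k => (pochhammer z k * (z + INR k))%C
  end.

(** Gauss hypergeometric series; used only for [Cmod z < 1] and [t] not a
    non-positive integer. *)
Definition hyp2F1 (r s t z : C) : C :=
  CSeries (fun n =>
    (pochhammer r n * pochhammer s n / (pochhammer t n * INR (fact n))
     * z ^ n)%C).

Definition not_nonpos_int (r : R) : Prop := forall n : nat, r <> - INR n.

Definition psi (beta gamma delta m : C) (x : R) : C :=
  (cpower x (m - (delta + 1) / 2)
   * hyp2F1 (m + (beta + gamma + 1) / 2) (m + (beta - gamma + 1) / 2)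
            (beta + 1) (RtoC (1 - x)))%C.

Definition Phi (a b c d : R) (m p : C) (x y : R) : C :=
  (psi b (2 * p) (2 * a + d + 2) m (x / (x + y))%R
   * psi c (d - b - c) (2 * a + b + d + 3) p (x + y)%R)%C.

Definition in_triangle (x y : R) : Prop := 0 < x /\ 0 < y /\ x + y < 1.

(** * Differential operators

    Functions are total on [R * R]; [Derive] depends only on the germ of its
    argument, so on the open triangle only the values there matter. *)

Definition fn := R -> R -> C.
Definition op := fn -> fn.

Definition CDerive (f : R -> C) (t : R) : C :=
  (Derive (fun s => Re (f s)) t, Derive (fun s => Im (f s)) t).

Definition dx : op := fun f x y => CDerive (fun s => f s y) x.
Definition dy : op := fun f x y => CDerive (fun s => f x s) y.

Definition has_partials_at (f : fn) (x y : R) : Prop :=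
  ex_derive (V := C_R_NormedModule) (fun s => f s y) x /\
  ex_derive (V := C_R_NormedModule) (fun s => f x s) y.

(** [f] lies in the domain of second-order differential operators at [(x, y)]:
    needed because [Derive] is total. *)
Definition has_second_partials_at (f : fn) (x y : R) : Prop :=
  has_partials_at f x y /\
  has_partials_at (dx f) x y /\ has_partials_at (dy f) x y.

Definition op_id : op := fun f => f.
Definition op_add (A B : op) : op := fun f x y => (A f x y + B f x y)%C.
Definition op_opp (A : op) : op := fun f x y => (- A f x y)%C.
Definition op_sub (A B : op) : op := fun f x y => (A f x y - B f x y)%C.
Definition op_comp (A B : op) : op := fun f => A (B f).
Definition op_scal (r : R) (A : op) : op := fun f x y => (RtoC r * A f x y)%C.

Definition mulop (g : R -> R -> R) : op := fun f x y => (RtoC (g x y) * f x y)%C.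

Declare Scope op_scope.
Delimit Scope op_scope with op.
Bind Scope op_scope with op.
Notation "A + B" := (op_add A B) : op_scope.
Notation "A - B" := (op_sub A B) : op_scope.
Notation "- A" := (op_opp A) : op_scope.
Notation "A * B" := (op_comp A B) : op_scope.
Notation "r *: A" := (op_scal r%R A)
  (at level 40, left associativity) : op_scope.
Notation "1" := op_id : op_scope.

Definition commutator (A B : op) : op := (A * B - B * A)%op.
Definition anticommutator (A B : op) : op := (A * B + B * A)%op.

Definition X1 : op := mulop (fun x y => x).
Definition X3 : op := mulop (fun x y => 1 - x - y).

Definition L3 (a b : R) : op :=
  (mulop (fun x y => x * y)%R * (dx * dx + dy * dy - 2 *: (dx * dy))
   + mulop (fun x y => (a + 1) * y - (b + 1) * x)%R * (dx - dy))%op.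

Definition L (a b c : R) : op :=
  (mulop (fun x y => x * (1 - x))%R * (dx * dx)
   + mulop (fun x y => y * (1 - y))%R * (dy * dy)
   - mulop (fun x y => 2 * x * y)%R * (dx * dy)
   + mulop (fun x y => a + 1 - (a + b + c + 3) * x)%R * dx
   + mulop (fun x y => b + 1 - (a + b + c + 3) * y)%R * dy)%op.

Definition C34 (a b : R) : op :=
  (- L3 a b + (((a + b + 1) ^ 2 - 1) / 4) *: 1)%op.

Definition C234 (a b c : R) : op :=
  (- L a b c + (((a + b + c + 2) ^ 2 - 1) / 4) *: 1)%op.

Definition C123 (a b c d : R) : op :=
  (((a + d + 2) / 2) *: commutator X1 (C234 a b c)
   - (1 / 2) *: anticommutator X1 (C234 a b c)
   - (((a + d + 2) ^ 2 - (d - b - c) ^ 2) / 4) *: X1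
   + ((a ^ 2 + (a + d + 2) ^ 2 - 2) / 4) *: 1)%op.

Definition C12 (a b c d : R) : op :=
  ((- ((a + d + 2) / 2)) *: commutator X3 (C234 a b c)
   + (1 / 2) *: anticommutator (X3 - 1) (C234 a b c)
   + (((a + d + 2) ^ 2 - (d - b - c) ^ 2) / 4) *: (X3 - 1)
   + C34 a b
   + (((a + d + 2) ^ 2 - 1) / 4) *: 1)%op.

(* Main.v *)
Require Import Defs.
From Stdlib Require Import Reals Lra Lia Factorial.
From Coquelicot Require Import Coquelicot.

(** Put [u = x / (x + y)] and [s = x + y].  In these coordinates [C12] becomes
    an ordinary differential operator in [s] alone, because the [u]-derivatives
    of [L3] cancel against those of [s L]; and [C123 - u (C12 - (4 p^2 - 1) / 4)]
    becomes an ordinary differential operator in [u] alone.  Both are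
    hypergeometric, with the exponents of the two [psi] factors of [Phi].  So the
    eigenvalue equations for [Phi = f(u) g(s)] are linear combinations of the
    differential equations of [f] and [g]. *)

Open Scope R_scope.

(** * Differentiation of complex-valued functions of a real variable *)

(** Stated on real and imaginary parts because [Defs.CDerive] and Coquelicot's
    product rule are real-valued. *)
Definition is_cderive (f : R -> C) (x : R) (l : C) : Prop :=
  is_derive (fun s => Re (f s)) x (Re l) /\
  is_derive (fun s => Im (f s)) x (Im l).

Lemma is_cderive_eq (f : R -> C) (x : R) (l l' : C) :
  is_cderive f x l -> l = l' -> is_cderive f x l'.
Proof. now intros H <-. Qed.

Lemma is_cderive_ext_loc (f g : R -> C) (x : R) (l : C) :
  locally x (fun s => f s = g s) -> is_cderive f x l -> is_cderive g x l.
Proof.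
intros H [H1 H2]; split;
  (eapply is_derive_ext_loc; [|eassumption]);
  (eapply filter_imp; [|exact H]); simpl; now intros s ->.
Qed.

Lemma CDerive_unique (f : R -> C) (x : R) (l : C) :
  is_cderive f x l -> CDerive f x = l.
Proof.
intros [H1 H2]; unfold CDerive.
apply is_derive_unique in H1; apply is_derive_unique in H2.
apply injective_projections; assumption.
Qed.

(** Bridge to the differentiability demanded by [has_partials_at]: [f] is the sum of the fixed
    vectors 1 and i of the real normed space C, multiplied by the differentiable real functions Re f
    and Im f. *)
Lemma is_cderive_ex_derive (f : R -> C) (x : R) (l : C) :
  is_cderive f x l -> ex_derive (V := C_R_NormedModule) f x.
Proof.
intros [H1 H2].
assert (E : forall z : C, @eq C
   (@plus C_R_NormedModule (@scal _ C_R_NormedModule (Re z) (1, 0))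
      (@scal _ C_R_NormedModule (Im z) (0, 1))) z).
{ intros [u v]; apply injective_projections; cbv -[Rplus Rmult IZR]; ring. }
eexists.
apply (is_derive_ext (V := C_R_NormedModule)) with (1 := fun s => E (f s)).
apply (is_derive_plus (V := C_R_NormedModule)).
- exact (is_derive_scal_l (V := C_R_NormedModule) _ _ _ _ H1).
- exact (is_derive_scal_l (V := C_R_NormedModule) _ _ _ _ H2).
Qed.

Lemma is_cderive_const (k : C) (x : R) : is_cderive (fun _ => k) x 0.
Proof. split; apply (is_derive_const (V := R_NormedModule)). Qed.

Lemma is_cderive_plus (f g : R -> C) (x : R) (l l' : C) :
  is_cderive f x l -> is_cderive g x l' ->
  is_cderive (fun s => f s + g s)%C x (l + l')%C.
Proof. intros [] []; split; now apply (is_derive_plus (V := R_NormedModule)). Qed.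

Lemma is_cderive_RtoC (g : R -> R) (x k : R) :
  is_derive g x k -> is_cderive (fun s => RtoC (g s)) x k.
Proof.
intros H; split; [exact H|exact (is_derive_const (V := R_NormedModule) 0 x)].
Qed.

Lemma is_cderive_mult (f g : R -> C) (x : R) (l l' : C) :
  is_cderive f x l -> is_cderive g x l' ->
  is_cderive (fun s => f s * g s)%C x (l * g x + f x * l')%C.
Proof.
intros [H1 H2] [H3 H4].
split.
- eapply is_derive_ext; [intros s; symmetry; apply re_mult|].
  replace (Re _) with
    (Re l * Re (g x) + Re (f x) * Re l' - (Im l * Im (g x) + Im (f x) * Im l'))
    by (rewrite re_plus, !re_mult; ring).
  apply (is_derive_minus (V := R_NormedModule));
    apply (is_derive_mult (K := R_AbsRing));
    trivial; apply Rmult_comm.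
- eapply is_derive_ext; [intros s; symmetry; apply im_mult|].
  replace (Im _) with
    (Re l * Im (g x) + Re (f x) * Im l' + (Im l * Re (g x) + Im (f x) * Re l'))
    by (rewrite im_plus, !im_mult; ring).
  apply (is_derive_plus (V := R_NormedModule));
    apply (is_derive_mult (K := R_AbsRing));
    trivial; apply Rmult_comm.
Qed.

Lemma is_cderive_comp (f : R -> C) (g : R -> R) (x k : R) (l : C) :
  is_cderive f (g x) l -> is_derive g x k ->
  is_cderive (fun s => f (g s)) x (RtoC k * l)%C.
Proof.
intros [H1 H2] H; split.
- rewrite re_scal_l; exact (is_derive_comp (fun s => Re (f s)) g x _ _ H1 H).
- rewrite im_scal_l; exact (is_derive_comp (fun s => Im (f s)) g x _ _ H2 H).
Qed.

Lemma is_cderive_cpower (e : C) (x : R) :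
  0 < x -> is_cderive (fun s => cpower s e) x (e / x * cpower x e)%C.
Proof.
intros Hx.
assert (Hx' : x <> 0) by lra.
assert (E : (e / x)%C = (RtoC (/ x) * e)%C)
  by (rewrite RtoC_inv by trivial; unfold Cdiv; ring).
rewrite E; clear E; unfold cpower; split.
- eapply is_derive_ext.
  { intros s; symmetry; rewrite re_scal_l; reflexivity. }
  simpl; auto_derive; [tauto|].
  unfold Re, Im; simpl; ring.
- eapply is_derive_ext.
  { intros s; symmetry; rewrite im_scal_l; reflexivity. }
  simpl; auto_derive; [tauto|].
  unfold Re, Im; simpl; ring.
Qed.

(** * Power series with complex coefficients at a real point *)

Lemma Ceq_ReIm (u v : C) : Re u = Re v -> Im u = Im v -> u = v.
Proof. intros; now apply injective_projections. Qed.

Definition CPSeries (u : nat -> C) (x : R) : C :=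
  (PSeries (fun n => Re (u n)) x, PSeries (fun n => Im (u n)) x).

Definition converges_on_unit_disk (u : nat -> C) : Prop :=
  Rbar_le 1 (CV_radius (fun n => Re (u n))) /\
  Rbar_le 1 (CV_radius (fun n => Im (u n))).

Definition coeff_derive (u : nat -> C) (n : nat) : C :=
  (RtoC (INR (S n)) * u (S n))%C.

Definition coeff_shift (u : nat -> C) (n : nat) : C :=
  match n with O => 0%C | S k => u k end.

(** Relational form of the sum. Sums, multiples and shifts of series can then be combined freely,
    and uniqueness of the sum turns an identity between coefficients into an equation between
    values. *)
Definition is_cpseries (u : nat -> C) (x : R) (l : C) : Prop :=
  is_pseries (fun n => Re (u n)) x (Re l) /\
  is_pseries (fun n => Im (u n)) x (Im l).

Lemma is_pseries_real_unique (u : nat -> R) (x l l' : R) :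
  is_pseries u x l -> is_pseries u x l' -> l = l'.
Proof.
intros H H'; rewrite <- (is_pseries_unique _ _ _ H).
now apply is_pseries_unique.
Qed.

Lemma is_cpseries_unique (u : nat -> C) (x : R) (l l' : C) :
  is_cpseries u x l -> is_cpseries u x l' -> l = l'.
Proof.
intros [] []; apply Ceq_ReIm; eapply is_pseries_real_unique; eassumption.
Qed.

Lemma is_cpseries_ext (u v : nat -> C) (x : R) (l : C) :
  (forall n, u n = v n) -> is_cpseries u x l -> is_cpseries v x l.
Proof.
intros H []; split; (eapply is_pseries_ext; [|eassumption]);
  intros n; simpl; now rewrite H.
Qed.

Lemma is_cpseries_zero (x : R) : is_cpseries (fun _ => 0%C) x 0.
Proof.
assert (H : is_pseries (fun _ : nat => 0) x 0).
{ apply (is_series_ext (fun _ => 0)).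
  - intros n; symmetry; apply Rmult_0_r.
  - apply filterlim_ext with (fun _ => 0); [|apply filterlim_const].
    intros n; induction n as [|n IH].
    + symmetry; apply sum_O.
    + rewrite sum_Sn, <- IH; symmetry; apply Rplus_0_l. }
split; exact H.
Qed.

Lemma is_cpseries_plus (u v : nat -> C) (x : R) (l l' : C) :
  is_cpseries u x l -> is_cpseries v x l' ->
  is_cpseries (fun n => u n + v n)%C x (l + l')%C.
Proof.
intros [] []; split.
- exact (is_pseries_plus (V := R_NormedModule) _ _ _ _ _ H H1).
- exact (is_pseries_plus (V := R_NormedModule) _ _ _ _ _ H0 H2).
Qed.

Lemma is_cpseries_scal (k : C) (u : nat -> C) (x : R) (l : C) :
  is_cpseries u x l -> is_cpseries (fun n => k * u n)%C x (k * l)%C.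
Proof.
intros [H1 H2].
pose proof (fun c => is_pseries_scal (V := R_NormedModule) c _ _ _
  (Rmult_comm x c) H1) as S1.
pose proof (fun c => is_pseries_scal (V := R_NormedModule) c _ _ _
  (Rmult_comm x c) H2) as S2.
split.
- rewrite re_mult.
  replace (_ - _) with (Re k * Re l + (- Im k) * Im l) by ring.
  eapply is_pseries_ext;
    [|exact (is_pseries_plus (V := R_NormedModule) _ _ _ _ _ (S1 _) (S2 _))].
  intros n; rewrite re_mult; cbv -[Rplus Rmult Ropp Rminus Re Im]; ring.
- rewrite im_mult.
  eapply is_pseries_ext;
    [|exact (is_pseries_plus (V := R_NormedModule) _ _ _ _ _ (S2 _) (S1 _))].
  intros n; rewrite im_mult; cbv -[Rplus Rmult Ropp Rminus Re Im]; ring.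
Qed.

Lemma is_cpseries_shift (u : nat -> C) (x : R) (l : C) :
  is_cpseries u x l -> is_cpseries (coeff_shift u) x (RtoC x * l)%C.
Proof.
intros [H1 H2]; split; rewrite ?re_scal_l, ?im_scal_l.
- eapply is_pseries_ext;
    [|exact (is_pseries_incr_1 (V := R_NormedModule) _ _ _ H1)].
  now intros [|n].
- eapply is_pseries_ext;
    [|exact (is_pseries_incr_1 (V := R_NormedModule) _ _ _ H2)].
  now intros [|n].
Qed.

Lemma CPSeries_correct (u : nat -> C) (x : R) :
  converges_on_unit_disk u -> Rabs x < 1 -> is_cpseries u x (CPSeries u x).
Proof.
intros [H1 H2] Hx; split; apply PSeries_correct; apply CV_radius_inside;
  (eapply Rbar_lt_le_trans; [|eassumption]); exact Hx.
Qed.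

Lemma converges_coeff_derive (u : nat -> C) :
  converges_on_unit_disk u -> converges_on_unit_disk (coeff_derive u).
Proof.
intros [H1 H2]; unfold coeff_derive; split.
- rewrite <- CV_radius_derive in H1.
  erewrite CV_radius_ext; [exact H1|].
  intros n; apply re_scal_l.
- rewrite <- CV_radius_derive in H2.
  erewrite CV_radius_ext; [exact H2|].
  intros n; apply im_scal_l.
Qed.

Lemma is_cderive_CPSeries (u : nat -> C) (x : R) :
  converges_on_unit_disk u -> Rabs x < 1 ->
  is_cderive (CPSeries u) x (CPSeries (coeff_derive u) x).
Proof.
intros [H1 H2] Hx; unfold coeff_derive; split; simpl.
- erewrite PSeries_ext; [apply is_derive_PSeries|intros n; apply re_scal_l].
  eapply Rbar_lt_le_trans; [|eassumption]; exact Hx.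
- erewrite PSeries_ext; [apply is_derive_PSeries|intros n; apply im_scal_l].
  eapply Rbar_lt_le_trans; [|eassumption]; exact Hx.
Qed.

Lemma bounded_initial_segment (u : nat -> R) (N : nat) :
  exists M, forall n, (n <= N)%nat -> u n <= M.
Proof.
induction N as [|N [M HM]].
- exists (u O); intros n Hn; replace n with O by lia; lra.
- exists (Rmax M (u (S N))); intros n Hn.
  destruct (Nat.eq_dec n (S N)) as [->|Hne]; [apply Rmax_r|].
  eapply Rle_trans; [apply HM; lia|apply Rmax_l].
Qed.

(** Ratio test without division, since the coefficients may vanish (a hypergeometric series can
    terminate). Beyond N the sequence |u_n| q^n does not increase, so it is bounded and the radius
    is at least q; then q tends to 1. *)
Lemma converges_of_ratio (u : nat -> C) :
  (forall q, 0 < q < 1 -> exists N, forall n, (N <= n)%nat ->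
     q * Cmod (u (S n)) <= Cmod (u n)) ->
  converges_on_unit_disk u.
Proof.
intros H.
assert (B : forall q, 0 < q < 1 ->
  exists M, forall n, Cmod (u n) * q ^ n <= M).
{ intros q Hq; destruct (H q Hq) as [N HN].
  destruct (bounded_initial_segment (fun n => Cmod (u n) * q ^ n) N)
    as [M HM].
  exists M; intros n; destruct (Nat.le_ge_cases n N) as [Hn|Hn]; [now apply HM|].
  induction Hn as [|n Hn IH]; [now apply HM|].
  eapply Rle_trans; [|exact IH]; simpl.
  assert (0 < q ^ n) by (apply pow_lt; lra).
  specialize (HN n Hn); nra. }
(* Any real sequence dominated by |u_n| is treated here, so that real and imaginary parts are both
   instances. *)
assert (L : forall v : nat -> R, (forall n, Rabs (v n) <= Cmod (u n)) ->
  Rbar_le 1 (CV_radius v)).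
{ intros v Hv.
  destruct (CV_radius_bounded v) as [Hub _].
  apply Rbar_not_lt_le; intros Hlt.
  assert (Hq : forall q, 0 < q < 1 -> Rbar_le q (CV_radius v)).
  { intros q Hq; apply Hub; destruct (B q Hq) as [M HM].
    exists M; intros n; rewrite Rabs_mult, (Rabs_right (q ^ n))
      by (apply Rle_ge, pow_le; lra).
    eapply Rle_trans; [|apply (HM n)].
    apply Rmult_le_compat_r; [apply pow_le; lra|apply Hv]. }
  (* The value q = 1/2 excludes a radius of minus infinity and gives z >= 1/2. If z < 1, then (z +
     1) / 2 is an admissible q larger than z, a contradiction. *)
  pose proof (Hq (1 / 2) ltac:(lra)) as H2.
  destruct (CV_radius v) as [z| |]; simpl in *; try lra.
  specialize (Hq ((z + 1) / 2) ltac:(lra)); lra. }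
split; apply L; intros n.
- apply re_le_Cmod.
- eapply Rle_trans; [apply Rmax_r|apply Rmax_Cmod].
Qed.

(** * The Gauss series, its differential equation, and the resulting equation for [psi] *)

Definition hyp_coeff (r s t : C) (n : nat) : C :=
  (pochhammer r n * pochhammer s n / (pochhammer t n * INR (fact n)))%C.

Lemma hyp2F1_CPSeries (r s t : C) (x : R) :
  hyp2F1 r s t x = CPSeries (hyp_coeff r s t) x.
Proof.
unfold hyp2F1, CSeries, CPSeries, hyp_coeff, PSeries; f_equal;
  apply Series_ext; intros n.
- now rewrite <- RtoC_pow, re_scal_r.
- now rewrite <- RtoC_pow, im_scal_r.
Qed.

Section Hypergeometric.

Variables r s t : C.
Hypothesis Ht : forall n : nat, (t + INR n <> 0)%C.

Lemma pochhammer_neq_0 (n : nat) : pochhammer t n <> 0%C.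
Proof.
induction n as [|n IH]; simpl.
- apply C1_nz.
- now apply Cmult_neq_0.
Qed.

Lemma RtoC_INR_S_neq_0 (n : nat) : (RtoC (INR n) + 1 <> 0)%C.
Proof.
rewrite <- RtoC_plus, <- S_INR; intros E;
apply RtoC_inj in E; revert E; apply not_0_INR; lia.
Qed.

(** The two-term recurrence, cleared of denominators. It drives both the convergence proof and the
    differential equation. *)
Lemma hyp_coeff_S (n : nat) :
  ((INR n + 1) * (t + INR n) * hyp_coeff r s t (S n)
   = (r + INR n) * (s + INR n) * hyp_coeff r s t n)%C.
Proof.
unfold hyp_coeff.
assert (F : INR (fact n) <> 0) by apply INR_fact_neq_0.
assert (F' : RtoC (INR (fact n)) <> 0%C)
  by (intros E; apply F; now apply RtoC_inj).
replace (RtoC (INR (fact (S n)))) with ((INR n + 1) * INR (fact n))%C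
  by (rewrite fact_simpl, mult_INR, S_INR, RtoC_mult, RtoC_plus; reflexivity).
simpl pochhammer; field; repeat split; auto using pochhammer_neq_0,
  RtoC_INR_S_neq_0.
Qed.

(** By the recurrence the ratio of consecutive coefficients is (r + n)(s + n) / ((n + 1)(t + n)),
    which tends to 1; the ratio test needs this as an explicit inequality. *)
Lemma hyp_coeff_converges : converges_on_unit_disk (hyp_coeff r s t).
Proof.
apply converges_of_ratio; intros q Hq.
set (A := Cmod r); set (B := Cmod s); set (T := Cmod t).
assert (HA : 0 <= A) by apply Cmod_ge_0.
assert (HB : 0 <= B) by apply Cmod_ge_0.
assert (HT : 0 <= T) by apply Cmod_ge_0.
(* K bounds the lower-order terms of q (A + k)(B + k) <= (k + 1)(k - T). That inequality holds as
   soon as k >= 1 and 2 K <= (1 - q) k, and N is chosen to ensure both. *)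
set (K := A + B + A * B + T).
destruct (nfloor_ex (Rmax 1 (2 * K / (1 - q)))) as [N HN].
{ eapply Rle_trans; [|apply Rmax_l]; lra. }
exists (S N); intros n Hn.
assert (Hn' : INR N + 1 <= INR n) by (rewrite <- S_INR; now apply le_INR).
assert (H1 : 1 <= INR n) by (pose proof (Rmax_l 1 (2 * K / (1 - q))); lra).
assert (H2 : 2 * K <= (1 - q) * INR n).
{ pose proof (Rmax_r 1 (2 * K / (1 - q))) as Hm.
  assert (Hd : 2 * K / (1 - q) <= INR n) by lra.
  apply (Rmult_le_compat_r (1 - q)) in Hd; [|lra].
  unfold Rdiv in Hd; rewrite Rmult_assoc, Rinv_l, Rmult_1_r in Hd by lra.
  lra. }
set (k := INR n) in *.
pose proof (f_equal Cmod (hyp_coeff_S n)) as E.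
rewrite !Cmod_mult in E; fold k in E.
assert (Ek : Cmod (k + 1)%C = k + 1)
  by (rewrite <- RtoC_plus, Cmod_R, Rabs_right; lra).
assert (Hk : Cmod k = k) by (rewrite Cmod_R, Rabs_right; lra).
assert (Er : Cmod (r + k)%C <= A + k)
  by (rewrite <- Hk at 2; apply Cmod_triangle).
assert (Es : Cmod (s + k)%C <= B + k)
  by (rewrite <- Hk at 2; apply Cmod_triangle).
assert (Et : k - T <= Cmod (t + k)%C).
{ pose proof (Cmod_triangle (t + k) (- t)) as Htr.
  replace (t + k + - t)%C with (RtoC k) in Htr by ring.
  rewrite Cmod_opp, Hk in Htr; fold T in Htr; lra. }
assert (Pt : 0 < Cmod (t + k)%C) by apply (proj1 (Cmod_gt_0 _) (Ht n)).
rewrite Ek in E.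
set (u := Cmod (hyp_coeff r s t n)) in *.
set (u' := Cmod (hyp_coeff r s t (S n))) in *.
assert (Hu : 0 <= u) by apply Cmod_ge_0.
assert (P : q * (Cmod (r + k)%C * Cmod (s + k)%C)
  <= (k + 1) * Cmod (t + k)%C).
{ apply Rle_trans with (q * ((A + k) * (B + k))).
  - apply Rmult_le_compat_l; [lra|].
    apply Rmult_le_compat; auto using Cmod_ge_0.
  - apply Rle_trans with ((k + 1) * (k - T));
      [|apply Rmult_le_compat_l; lra].
    assert (HAB : 0 <= A * B) by now apply Rmult_le_pos.
    assert (G1 : q * (A + B) * k <= (A + B) * k).
    { apply Rmult_le_compat_r; [lra|nra]. }
    assert (G2 : q * (A * B) <= A * B) by nra.
    assert (G3 : 2 * K * k <= (1 - q) * k * k)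
      by (apply Rmult_le_compat_r; lra).
    assert (G4 : A * B + T <= (A * B + T) * k) by nra.
    assert (G5 : 0 <= (A + B) * k) by (apply Rmult_le_pos; lra).
    assert (G6 : 0 <= A * B * k) by (apply Rmult_le_pos; lra).
    unfold K in G3; lra. }
(* Multiplying by the positive number (k + 1) |t + k| makes the modulus of the recurrence applicable
   to u'. *)
apply Rmult_le_reg_l with ((k + 1) * Cmod (t + k)%C); [nra|].
replace ((k + 1) * Cmod (t + k)%C * (q * u'))
  with (q * ((k + 1) * Cmod (t + k)%C * u')) by ring.
rewrite E.
replace (q * (Cmod (r + k)%C * Cmod (s + k)%C * u))
  with (q * (Cmod (r + k)%C * Cmod (s + k)%C) * u) by ring.
now apply Rmult_le_compat_r.
Qed.

Let F := CPSeries (hyp_coeff r s t).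
Let F1 := CPSeries (coeff_derive (hyp_coeff r s t)).
Let F2 := CPSeries (coeff_derive (coeff_derive (hyp_coeff r s t))).

(** The left side is itself the sum of a power series, and its n-th coefficient is the difference of
    the two sides of the recurrence at n. *)
Lemma hyp_ode (x : R) : Rabs x < 1 ->
  (x * (1 - x) * F2 x + (t - (r + s + 1) * x) * F1 x - r * s * F x = 0)%C.
Proof.
intros Hx.
pose proof hyp_coeff_converges as V0.
pose proof (converges_coeff_derive _ V0) as V1.
pose proof (converges_coeff_derive _ V1) as V2.
apply CPSeries_correct with (x := x) in V0, V1, V2; trivial.
fold F in V0; fold F1 in V1; fold F2 in V2.
apply is_cpseries_unique with (2 := is_cpseries_zero x).
pose proof (is_cpseries_plus _ _ _ _ _
  (is_cpseries_plus _ _ _ _ _ (is_cpseries_shift _ _ _ V2)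
     (is_cpseries_scal (-1) _ _ _
        (is_cpseries_shift _ _ _ (is_cpseries_shift _ _ _ V2))))
  (is_cpseries_plus _ _ _ _ _
     (is_cpseries_plus _ _ _ _ _ (is_cpseries_scal t _ _ _ V1)
        (is_cpseries_scal (- (r + s + 1)) _ _ _ (is_cpseries_shift _ _ _ V1)))
     (is_cpseries_scal (- (r * s)) _ _ _ V0))) as H.
replace (_ - _)%C with
  (x * F2 x + -1 * (x * (x * F2 x)) + (t * F1 x + - (r + s + 1) * (x * F1 x)
     + - (r * s) * F x))%C by ring.
eapply is_cpseries_ext; [|exact H].
(* Multiplication by x kills the coefficient of index 0, and multiplication by x^2 those of index 0
   and 1, so these two indices are separate cases. *)
intros [|[|n]]; simpl coeff_shift; unfold coeff_derive.
- pose proof (hyp_coeff_S 0) as R0; simpl INR in *.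
  transitivity ((0 + 1) * (t + 0) * hyp_coeff r s t 1
    - (r + 0) * (s + 0) * hyp_coeff r s t 0)%C; [ring|rewrite R0; ring].
- pose proof (hyp_coeff_S 1) as R1; rewrite !S_INR, !RtoC_plus in *.
  simpl INR in *.
  transitivity ((0 + 1 + 1) * (t + (0 + 1)) * hyp_coeff r s t 2
    - (r + (0 + 1)) * (s + (0 + 1)) * hyp_coeff r s t 1)%C; [ring|rewrite R1; ring].
- pose proof (hyp_coeff_S (S (S n))) as Rn; rewrite !S_INR, !RtoC_plus in *.
  set (k := RtoC (INR n)) in *.
  transitivity ((k + 1 + 1 + 1) * (t + (k + 1 + 1)) * hyp_coeff r s t (S (S (S n)))
    - (r + (k + 1 + 1)) * (s + (k + 1 + 1)) * hyp_coeff r s t (S (S n)))%C;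
    [ring|rewrite Rn; ring].
Qed.
End Hypergeometric.

(** Obtained by inserting x^e F(1 - x) into the Gauss equation at 1 - x. The existential hides the
    formulas for the derivatives, as only the equation is used later. Both [m] and [gamma] enter it
    only through their squares. *)
Lemma psi_ode (beta gamma delta m : C) :
  (forall n : nat, (beta + 1 + INR n <> 0)%C) ->
  exists f1 f2 : R -> C, forall x, 0 < x < 1 ->
    is_cderive (psi beta gamma delta m) x (f1 x) /\
    is_cderive f1 x (f2 x) /\
    (x ^ 2 * (1 - x) * f2 x
     = (beta + 1 - (delta + beta + 3) * (1 - x)) * x * f1 x
       + (m ^ 2 - (delta + 1) ^ 2 / 4
          + x * (((beta + delta + 2) ^ 2 - gamma ^ 2) / 4))
         * psi beta gamma delta m x)%C.
Proof.
intros Hb.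
set (r := (m + (beta + gamma + 1) / 2)%C).
set (s := (m + (beta - gamma + 1) / 2)%C).
set (e := (m - (delta + 1) / 2)%C).
set (c := hyp_coeff r s (beta + 1)).
set (F := CPSeries c).
set (F1 := CPSeries (coeff_derive c)).
set (F2 := CPSeries (coeff_derive (coeff_derive c))).
pose proof (hyp_coeff_converges r s _ Hb) as V0.
pose proof (converges_coeff_derive _ V0) as V1.
set (P := fun x => cpower x e).
set (I := fun x => RtoC (/ x)).
assert (D1 : forall x, is_derive (fun z => 1 - z) x (-1)).
{ intros x; auto_derive; [trivial|ring]. }
(* Product rule for x^e F(1 - x). The factor 1/x is kept as the function [I] so that the expression
   can be differentiated again; the factor -1 is the derivative of 1 - x. *)
exists (fun x => e * I x * (P x * F (1 - x)%R) + P x * (RtoC (-1) * F1 (1 - x)%R))%C.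
exists (fun x => e * (e - 1) * (I x * I x) * (P x * F (1 - x)%R)
  + RtoC (-2) * e * I x * (P x * F1 (1 - x)%R) + P x * F2 (1 - x)%R)%C.
intros x Hx.
assert (Hx0 : x <> 0) by lra.
assert (Hd : Rabs (1 - x) < 1) by (rewrite Rabs_right; lra).
assert (DF : is_cderive (fun z => F (1 - z)) x (RtoC (-1) * F1 (1 - x)%R)%C).
{ apply is_cderive_comp; [|apply D1]; now apply is_cderive_CPSeries. }
assert (DF1 : is_cderive (fun z => F1 (1 - z)) x (RtoC (-1) * F2 (1 - x)%R)%C).
{ apply is_cderive_comp; [|apply D1]; now apply is_cderive_CPSeries. }
assert (DP : is_cderive P x (e * I x * P x)%C).
{ eapply is_cderive_eq; [apply is_cderive_cpower; lra|].
  unfold I, P; rewrite RtoC_inv by trivial; reflexivity. }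
assert (DI : is_cderive I x (- (I x * I x))%C).
{ eapply is_cderive_eq.
  - apply is_cderive_RtoC; auto_derive; [trivial|reflexivity].
  - unfold I; rewrite <- RtoC_mult, <- RtoC_opp; f_equal; now field. }
split; [|split].
- eapply is_cderive_eq.
  + apply is_cderive_ext_loc with (f := fun z => (P z * F (1 - z)%R)%C).
    * apply filter_forall; intros z; unfold psi.
      rewrite hyp2F1_CPSeries; reflexivity.
    * apply is_cderive_mult; [exact DP|exact DF].
  + simpl; ring.
- eapply is_cderive_eq.
  + apply is_cderive_plus.
    * apply is_cderive_mult; [|apply is_cderive_mult; [exact DP|exact DF]].
      apply is_cderive_mult; [apply is_cderive_const|exact DI].
    * apply is_cderive_mult; [exact DP|].
      apply is_cderive_mult; [apply is_cderive_const|exact DF1].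
  + simpl; replace (RtoC (-2)) with (-(2))%C by now rewrite <- RtoC_opp.
    replace (RtoC (-1)) with (-(1))%C by now rewrite <- RtoC_opp.
    ring.
- unfold psi; fold e r s; rewrite hyp2F1_CPSeries; fold c; fold F.
  pose proof (hyp_ode r s _ Hb _ Hd) as O.
  fold c in O; fold F in O; fold F1 in O; fold F2 in O.
  fold (P x).
  replace (RtoC (1 - x)) with (1 - x)%C in O by now rewrite RtoC_minus.
  unfold I; rewrite RtoC_inv by trivial.
  replace (RtoC (-2)) with (-(2))%C by now rewrite <- RtoC_opp.
  replace (RtoC (-1)) with (-(1))%C by now rewrite <- RtoC_opp.
  set (f := F (1 - x)%R) in *; set (f1 := F1 (1 - x)%R) in *;
  set (f2 := F2 (1 - x)%R) in *; set (w := P x).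
  assert (Hxc : RtoC x <> 0%C) by (intros E; apply RtoC_inj in E; lra).
  (* Subtracting x * w times the Gauss equation at 1 - x, which is zero, eliminates the second
     derivative [f2]. What remains is a rational identity in x and the parameters. *)
  match goal with |- ?L = _ => transitivity
   (L - x * w * ((1 - x) * (1 - (1 - x)) * f2 +
      (beta + 1 - (r + s + 1) * (1 - x)) * f1 - r * s * f))%C end.
  + rewrite O; ring.
  + subst r s e; field; trivial.
Qed.

(** * Second-order jets on the triangle and the action of the operators on them *)

(** Certified partial derivatives up to order two, on the triangle only. The single [h12] serves
    both mixed orders, and every second-order operator becomes an algebraic expression in the
    jet. *)
Record jet2 (h h1 h2 h11 h12 h22 : fn) : Prop := {
  jet_x : forall x y, in_triangle x y ->
    is_cderive (fun s => h s y) x (h1 x y);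
  jet_y : forall x y, in_triangle x y ->
    is_cderive (fun s => h x s) y (h2 x y);
  jet_xx : forall x y, in_triangle x y ->
    is_cderive (fun s => h1 s y) x (h11 x y);
  jet_xy : forall x y, in_triangle x y ->
    is_cderive (fun s => h2 s y) x (h12 x y);
  jet_yx : forall x y, in_triangle x y ->
    is_cderive (fun s => h1 x s) y (h12 x y);
  jet_yy : forall x y, in_triangle x y ->
    is_cderive (fun s => h2 x s) y (h22 x y) }.

(** [dx h] and [dy h] are known to agree with [h1] and [h2] on the triangle only. Differentiating
    them again requires this agreement on a neighbourhood. *)
Lemma in_triangle_locally_x (x y : R) :
  in_triangle x y -> locally x (fun s => in_triangle s y).
Proof.
intros (Hx & Hy & Hs).
assert (Hlt : 0 < 1 - x - y) by lra.
assert (Hd : 0 < Rmin x (1 - x - y)) by now apply Rmin_pos.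
exists (mkposreal _ Hd); intros s Hb.
change (Rabs (s - x) < Rmin x (1 - x - y)) in Hb.
pose proof (Rmin_l x (1 - x - y)); pose proof (Rmin_r x (1 - x - y)).
apply Rabs_def2 in Hb; unfold in_triangle; lra.
Qed.

Lemma in_triangle_locally_y (x y : R) :
  in_triangle x y -> locally y (fun s => in_triangle x s).
Proof.
intros H; assert (H' : in_triangle y x) by (unfold in_triangle in *; lra).
generalize (in_triangle_locally_x _ _ H'); apply filter_imp.
unfold in_triangle; intros s; simpl; lra.
Qed.

Section Jets.

Variables h h1 h2 h11 h12 h22 : fn.
Hypothesis J : jet2 h h1 h2 h11 h12 h22.

Lemma jet2_dx (x y : R) : in_triangle x y -> dx h x y = h1 x y.
Proof. intros H; apply CDerive_unique; now apply (jet_x _ _ _ _ _ _ J). Qed.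

Lemma jet2_dy (x y : R) : in_triangle x y -> dy h x y = h2 x y.
Proof. intros H; apply CDerive_unique; now apply (jet_y _ _ _ _ _ _ J). Qed.

Lemma jet2_is_dxx (x y : R) : in_triangle x y ->
  is_cderive (fun s => dx h s y) x (h11 x y).
Proof.
intros H; apply is_cderive_ext_loc with (f := fun s => h1 s y);
  [|now apply (jet_xx _ _ _ _ _ _ J)].
generalize (in_triangle_locally_x _ _ H); apply filter_imp.
intros s Hs; symmetry; now apply jet2_dx.
Qed.

Lemma jet2_is_dxy (x y : R) : in_triangle x y ->
  is_cderive (fun s => dy h s y) x (h12 x y).
Proof.
intros H; apply is_cderive_ext_loc with (f := fun s => h2 s y);
  [|now apply (jet_xy _ _ _ _ _ _ J)].
generalize (in_triangle_locally_x _ _ H); apply filter_imp.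
intros s Hs; symmetry; now apply jet2_dy.
Qed.

Lemma jet2_is_dyx (x y : R) : in_triangle x y ->
  is_cderive (fun s => dx h x s) y (h12 x y).
Proof.
intros H; apply is_cderive_ext_loc with (f := fun s => h1 x s);
  [|now apply (jet_yx _ _ _ _ _ _ J)].
generalize (in_triangle_locally_y _ _ H); apply filter_imp.
intros s Hs; symmetry; now apply jet2_dx.
Qed.

Lemma jet2_is_dyy (x y : R) : in_triangle x y ->
  is_cderive (fun s => dy h x s) y (h22 x y).
Proof.
intros H; apply is_cderive_ext_loc with (f := fun s => h2 x s);
  [|now apply (jet_yy _ _ _ _ _ _ J)].
generalize (in_triangle_locally_y _ _ H); apply filter_imp.
intros s Hs; symmetry; now apply jet2_dy.
Qed.

Lemma jet2_has_second_partials_at (x y : R) :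
  in_triangle x y -> has_second_partials_at h x y.
Proof.
intros H; repeat split; eapply is_cderive_ex_derive.
- now apply (jet_x _ _ _ _ _ _ J).
- now apply (jet_y _ _ _ _ _ _ J).
- now apply jet2_is_dxx.
- now apply jet2_is_dyx.
- now apply jet2_is_dxy.
- now apply jet2_is_dyy.
Qed.

Lemma L_jet2 (a b c x y : R) : in_triangle x y ->
  L a b c h x y =
  (x * (1 - x) * h11 x y + y * (1 - y) * h22 x y - 2 * x * y * h12 x y
   + (a + 1 - (a + b + c + 3) * x) * h1 x y
   + (b + 1 - (a + b + c + 3) * y) * h2 x y)%C.
Proof.
intros H; unfold L, op_sub, op_add, op_comp, mulop.
rewrite jet2_dx, jet2_dy by trivial.
replace (dx (dx h) x y) with (h11 x y)
  by (symmetry; apply CDerive_unique; now apply jet2_is_dxx).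
replace (dx (dy h) x y) with (h12 x y)
  by (symmetry; apply CDerive_unique; now apply jet2_is_dxy).
replace (dy (dy h) x y) with (h22 x y)
  by (symmetry; apply CDerive_unique; now apply jet2_is_dyy).
now repeat rewrite ?RtoC_plus, ?RtoC_minus, ?RtoC_mult.
Qed.

Lemma L3_jet2 (a b x y : R) : in_triangle x y ->
  L3 a b h x y =
  (x * y * (h11 x y + h22 x y - 2 * h12 x y)
   + ((a + 1) * y - (b + 1) * x) * (h1 x y - h2 x y))%C.
Proof.
intros H; unfold L3, op_sub, op_add, op_comp, op_scal, mulop.
rewrite jet2_dx, jet2_dy by trivial.
replace (dx (dx h) x y) with (h11 x y)
  by (symmetry; apply CDerive_unique; now apply jet2_is_dxx).
replace (dx (dy h) x y) with (h12 x y)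
  by (symmetry; apply CDerive_unique; now apply jet2_is_dxy).
replace (dy (dy h) x y) with (h22 x y)
  by (symmetry; apply CDerive_unique; now apply jet2_is_dyy).
now repeat rewrite ?RtoC_plus, ?RtoC_minus, ?RtoC_mult.
Qed.

(** Leibniz rule for an affine multiplier, whose second derivatives vanish. The multipliers of [X1],
    [X3] and [X3 - 1] are all of this kind. *)
Lemma jet2_affine (k0 k1 k2 : R) (g : fn) :
  (forall x y, g x y = (RtoC (k0 + k1 * x + k2 * y) * h x y)%C) ->
  let k := fun x y => RtoC (k0 + k1 * x + k2 * y) in
  jet2 g
    (fun x y => RtoC k1 * h x y + k x y * h1 x y)%C
    (fun x y => RtoC k2 * h x y + k x y * h2 x y)%C
    (fun x y => 2 * RtoC k1 * h1 x y + k x y * h11 x y)%C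
    (fun x y => RtoC k1 * h2 x y + RtoC k2 * h1 x y + k x y * h12 x y)%C
    (fun x y => 2 * RtoC k2 * h2 x y + k x y * h22 x y)%C.
Proof.
intros Hg k.
assert (Kx : forall x y, is_cderive (fun s => k s y) x k1).
{ intros x y; apply is_cderive_RtoC; auto_derive; [trivial|ring]. }
assert (Ky : forall x y, is_cderive (fun s => k x s) y k2).
{ intros x y; apply is_cderive_RtoC; auto_derive; [trivial|ring]. }
destruct J as [Jx Jy Jxx Jxy Jyx Jyy].
split; intros x y H.
- eapply is_cderive_ext_loc;
    [apply filter_forall; intros s; symmetry; apply Hg|].
  exact (is_cderive_mult _ _ _ _ _ (Kx x y) (Jx x y H)).
- eapply is_cderive_ext_loc;
    [apply filter_forall; intros s; symmetry; apply Hg|].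
  exact (is_cderive_mult _ _ _ _ _ (Ky x y) (Jy x y H)).
- eapply is_cderive_eq.
  + apply is_cderive_plus; apply is_cderive_mult;
      [apply is_cderive_const|apply Jx|apply Kx|apply Jxx]; trivial.
  + simpl; ring.
- eapply is_cderive_eq.
  + apply is_cderive_plus; apply is_cderive_mult;
      [apply is_cderive_const|apply Jx|apply Kx|apply Jxy]; trivial.
  + simpl; ring.
- eapply is_cderive_eq.
  + apply is_cderive_plus; apply is_cderive_mult;
      [apply is_cderive_const|apply Jy|apply Ky|apply Jyx]; trivial.
  + simpl; ring.
- eapply is_cderive_eq.
  + apply is_cderive_plus; apply is_cderive_mult;
      [apply is_cderive_const|apply Jy|apply Ky|apply Jyy]; trivial.
  + simpl; ring.
Qed.

End Jets.

(** The commutator of [L] with an affine function k has order one. Its first-order terms come from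
    the cross terms of the Leibniz rule, and its term in [h] is L k, to which only the first-order
    part of [L] contributes. *)
Lemma C234_affine (h h1 h2 h11 h12 h22 : fn) (a b c k0 k1 k2 : R) (g : fn)
    (x y : R) :
  jet2 h h1 h2 h11 h12 h22 ->
  (forall x y, g x y = (RtoC (k0 + k1 * x + k2 * y) * h x y)%C) ->
  in_triangle x y ->
  C234 a b c g x y =
  ((k0 + k1 * x + k2 * y) * C234 a b c h x y
   - 2 * x * (k1 * (1 - x) - k2 * y) * h1 x y
   - 2 * y * (k2 * (1 - y) - k1 * x) * h2 x y
   - (k1 * (a + 1 - (a + b + c + 3) * x)
      + k2 * (b + 1 - (a + b + c + 3) * y)) * h x y)%C.
Proof.
intros J Hg H.
pose proof (jet2_affine _ _ _ _ _ _ J _ _ _ _ Hg) as Jg; simpl in Jg.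
unfold C234, op_add, op_opp, op_scal, op_id.
rewrite (L_jet2 _ _ _ _ _ _ J) by trivial.
rewrite (L_jet2 _ _ _ _ _ _ Jg) by trivial.
rewrite Hg; repeat rewrite ?RtoC_plus, ?RtoC_mult; ring.
Qed.

(** * The coordinates u = x / (x + y), s = x + y and separated functions f(u) g(s) *)

Lemma in_triangle_polar (x y : R) :
  in_triangle x y -> 0 < x / (x + y) < 1 /\ 0 < x + y < 1.
Proof.
intros (Hx & Hy & Hs); split; [|lra].
split; [apply Rdiv_lt_0_compat; lra|].
apply Rmult_lt_reg_r with (x + y); [lra|].
unfold Rdiv; rewrite Rmult_assoc, Rinv_l by lra; lra.
Qed.

Section Polar.

Variables f f1 f2 g g1 g2 : R -> C.
Hypothesis Hf : forall t, 0 < t < 1 -> is_cderive f t (f1 t).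
Hypothesis Hf1 : forall t, 0 < t < 1 -> is_cderive f1 t (f2 t).
Hypothesis Hg : forall t, 0 < t < 1 -> is_cderive g t (g1 t).
Hypothesis Hg1 : forall t, 0 < t < 1 -> is_cderive g1 t (g2 t).

Let u (x y : R) : R := x / (x + y).
Let ux (x y : R) : R := y / (x + y) ^ 2.
Let uy (x y : R) : R := - x / (x + y) ^ 2.

Lemma is_cderive_angle (F : R -> C) (l : C) (x y : R) :
  in_triangle x y -> is_cderive F (u x y) l ->
  is_cderive (fun s => F (u s y)) x (ux x y * l)%C /\
  is_cderive (fun s => F (u x s)) y (uy x y * l)%C.
Proof.
intros (Hx & Hy & Hs) H; unfold u, ux, uy in *; split.
- apply is_cderive_comp; [exact H|].
  auto_derive; [lra|field; lra].
- apply (is_cderive_comp F (fun s => x / (x + s))); [exact H|].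
  auto_derive; [lra|field; lra].
Qed.

Lemma is_cderive_radius (G : R -> C) (l : C) (x y : R) :
  is_cderive G (x + y) l ->
  is_cderive (fun s => G (s + y)) x l /\ is_cderive (fun s => G (x + s)) y l.
Proof.
intros H; split; (eapply is_cderive_eq; [|apply Cmult_1_l]).
- apply is_cderive_comp; [exact H|auto_derive; [trivial|ring]].
- apply (is_cderive_comp G (fun s => x + s)); [exact H|].
  auto_derive; [trivial|ring].
Qed.

(** Chain rule: both partial derivatives of s are 1, those of u are [ux] and [uy], and the cubic
    quotients are the second derivatives of u. *)
Lemma jet2_polar :
  jet2 (fun x y => f (u x y) * g (x + y)%R)%C
    (fun x y => ux x y * (f1 (u x y) * g (x + y)%R) + f (u x y) * g1 (x + y)%R)%C
    (fun x y => uy x y * (f1 (u x y) * g (x + y)%R) + f (u x y) * g1 (x + y)%R)%C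
    (fun x y => RtoC (- 2 * y / (x + y) ^ 3) * (f1 (u x y) * g (x + y)%R)
       + ux x y * (ux x y * f2 (u x y) * g (x + y)%R)
       + 2 * ux x y * (f1 (u x y) * g1 (x + y)%R) + f (u x y) * g2 (x + y)%R)%C
    (fun x y => RtoC ((x - y) / (x + y) ^ 3) * (f1 (u x y) * g (x + y)%R)
       + ux x y * (uy x y * f2 (u x y) * g (x + y)%R)
       + (ux x y + uy x y) * (f1 (u x y) * g1 (x + y)%R)
       + f (u x y) * g2 (x + y)%R)%C
    (fun x y => RtoC (2 * x / (x + y) ^ 3) * (f1 (u x y) * g (x + y)%R)
       + uy x y * (uy x y * f2 (u x y) * g (x + y)%R)
       + 2 * uy x y * (f1 (u x y) * g1 (x + y)%R) + f (u x y) * g2 (x + y)%R)%C.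
Proof.
split; intros x y H; destruct (in_triangle_polar _ _ H) as [Hu Hs];
fold (u x y) in Hu;
destruct (is_cderive_angle _ _ _ _ H (Hf _ Hu)) as [Dfx Dfy];
destruct (is_cderive_angle _ _ _ _ H (Hf1 _ Hu)) as [Df1x Df1y];
destruct (is_cderive_radius _ _ _ _ (Hg _ Hs)) as [Dgx Dgy];
destruct (is_cderive_radius _ _ _ _ (Hg1 _ Hs)) as [Dg1x Dg1y];
assert (Hxy : x + y <> 0) by lra.
- eapply is_cderive_eq; [exact (is_cderive_mult _ _ _ _ _ Dfx Dgx)|].
  simpl; ring.
- eapply is_cderive_eq; [exact (is_cderive_mult _ _ _ _ _ Dfy Dgy)|].
  simpl; ring.
- assert (Du : is_cderive (fun s => RtoC (ux s y)) x
    (RtoC (- 2 * y / (x + y) ^ 3))).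
  { apply is_cderive_RtoC; unfold ux; auto_derive; [|field; lra].
    now repeat apply Rmult_integral_contrapositive_currified; try lra. }
  eapply is_cderive_eq; [exact (is_cderive_plus _ _ _ _ _
    (is_cderive_mult _ _ _ _ _ Du (is_cderive_mult _ _ _ _ _ Df1x Dgx))
    (is_cderive_mult _ _ _ _ _ Dfx Dg1x))|].
  simpl; ring.
- assert (Du : is_cderive (fun s => RtoC (uy s y)) x
    (RtoC ((x - y) / (x + y) ^ 3))).
  { apply is_cderive_RtoC; unfold uy; auto_derive; [|field; lra].
    now repeat apply Rmult_integral_contrapositive_currified; try lra. }
  eapply is_cderive_eq; [exact (is_cderive_plus _ _ _ _ _
    (is_cderive_mult _ _ _ _ _ Du (is_cderive_mult _ _ _ _ _ Df1x Dgx))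
    (is_cderive_mult _ _ _ _ _ Dfx Dg1x))|].
  simpl; ring.
- assert (Du : is_cderive (fun s => RtoC (ux x s)) y
    (RtoC ((x - y) / (x + y) ^ 3))).
  { apply is_cderive_RtoC; unfold ux; auto_derive; [|field; lra].
    now repeat apply Rmult_integral_contrapositive_currified; try lra. }
  eapply is_cderive_eq; [exact (is_cderive_plus _ _ _ _ _
    (is_cderive_mult _ _ _ _ _ Du (is_cderive_mult _ _ _ _ _ Df1y Dgy))
    (is_cderive_mult _ _ _ _ _ Dfy Dg1y))|].
  simpl; ring.
- assert (Du : is_cderive (fun s => RtoC (uy x s)) y
    (RtoC (2 * x / (x + y) ^ 3))).
  { apply is_cderive_RtoC; unfold uy; auto_derive; [|field; lra].
    now repeat apply Rmult_integral_contrapositive_currified; try lra. }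
  eapply is_cderive_eq; [exact (is_cderive_plus _ _ _ _ _
    (is_cderive_mult _ _ _ _ _ Du (is_cderive_mult _ _ _ _ _ Df1y Dgy))
    (is_cderive_mult _ _ _ _ _ Dfy Dg1y))|].
  simpl; ring.
Qed.

End Polar.

(** * Explicit forms of [C12] and [C123] *)

Ltac push_RtoC :=
  repeat first [ rewrite RtoC_plus | rewrite RtoC_minus | rewrite RtoC_mult
               | rewrite RtoC_opp | rewrite RtoC_pow
               | rewrite RtoC_div by (try apply pow_nonzero; lra) ].

(** Only radial derivatives survive: x h1 + y h2 is s times the s-derivative at fixed u, and the
    second-order bracket is s^2 times the second s-derivative. The coefficients are those of
    [psi_ode] for the factor of [Phi] in s. *)
Lemma C12_jet2 (h h1 h2 h11 h12 h22 : fn) (a b c d x y : R) :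
  jet2 h h1 h2 h11 h12 h22 -> in_triangle x y ->
  C12 a b c d h x y =
  ((1 - (x + y)) * (x ^ 2 * h11 x y + 2 * x * y * h12 x y + y ^ 2 * h22 x y)
   + (2 * a + b + d + 5 - (2 * a + b + c + d + 6) * (x + y))
     * (x * h1 x y + y * h2 x y)
   + ((2 * a + b + d + 4) ^ 2 / 4 - 1 / 4
      - (x + y) * (((2 * a + b + c + d + 5) ^ 2 - (d - b - c) ^ 2) / 4))
     * h x y)%C.
Proof.
intros J H.
assert (E3 : forall x y, X3 h x y = (RtoC (1 + -1 * x + -1 * y) * h x y)%C).
{ intros x' y'; unfold X3, mulop; do 2 f_equal; ring. }
(* [X3 - 1] is treated as the single multiplier -(x + y), so its anticommutator also falls under
   [C234_affine]. *)
assert (E31 : forall x y,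
  (X3 - 1)%op h x y = (RtoC (0 + -1 * x + -1 * y) * h x y)%C).
{ intros x' y'; unfold op_sub, X3, op_id, mulop; push_RtoC; ring. }
apply (C234_affine _ _ _ _ _ _ a b c _ _ _ _ x y J) in E3, E31; trivial.
unfold C12, commutator, anticommutator; unfold op_add, op_sub, op_comp, op_scal.
fold (op_sub X3 op_id h).
rewrite E3, E31; unfold C34, C234, X3, mulop, op_add, op_opp, op_scal, op_id.
rewrite (L_jet2 _ _ _ _ _ _ J), (L3_jet2 _ _ _ _ _ _ J) by trivial.
push_RtoC; field.
Qed.

(** The bracket multiplied by x is [L] with a replaced by 2a + d + 3. The constant (2a + d + 3)^2 /
    4 is the (delta + 1)^2 / 4 of the factor of [Phi] in u. *)
Lemma C123_jet2 (h h1 h2 h11 h12 h22 : fn) (a b c d x y : R) :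
  jet2 h h1 h2 h11 h12 h22 -> in_triangle x y ->
  C123 a b c d h x y =
  (x * (x * (1 - x) * h11 x y - 2 * x * y * h12 x y + y * (1 - y) * h22 x y
        + (2 * a + d + 4 - (2 * a + b + c + d + 6) * x) * h1 x y
        + (b + 1 - (2 * a + b + c + d + 6) * y) * h2 x y)
   + ((2 * a + d + 3) ^ 2 / 4 - 1 / 4
      - x * (((2 * a + b + c + d + 5) ^ 2 - (d - b - c) ^ 2) / 4))
     * h x y)%C.
Proof.
intros J H.
assert (E1 : forall x y, X1 h x y = (RtoC (0 + 1 * x + 0 * y) * h x y)%C).
{ intros x' y'; unfold X1, mulop; do 2 f_equal; ring. }
apply (C234_affine _ _ _ _ _ _ a b c _ _ _ _ x y J) in E1; trivial.
unfold C123, commutator, anticommutator; unfold op_add, op_sub, op_comp, op_scal.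
rewrite E1; unfold C234, X1, mulop, op_add, op_opp, op_scal, op_id.
rewrite (L_jet2 _ _ _ _ _ _ J) by trivial.
push_RtoC; field.
Qed.

(** * The eigenvalue equations of [Phi] *)

Theorem theorem4p3 (a b c d : R) (m p : C)
  (hb : not_nonpos_int (b + 1)) (hc : not_nonpos_int (c + 1)) :
  forall x y : R, in_triangle x y ->
    has_second_partials_at (Phi a b c d m p) x y /\
    C12 a b c d (Phi a b c d m p) x y
      = ((4 * p ^ 2 - 1) / 4 * Phi a b c d m p x y)%C /\
    C123 a b c d (Phi a b c d m p) x y
      = ((4 * m ^ 2 - 1) / 4 * Phi a b c d m p x y)%C.
Proof.
assert (G : forall r, not_nonpos_int (r + 1) ->
  forall n : nat, (RtoC r + 1 + INR n <> 0)%C).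
{ intros r Hr n E; rewrite <- !RtoC_plus in E; apply RtoC_inj in E.
  apply (Hr n); lra. }
destruct (psi_ode b (2 * p) (2 * a + d + 2) m (G b hb)) as (f1 & f2 & Hf).
destruct (psi_ode c (d - b - c) (2 * a + b + d + 3) p (G c hc))
  as (g1 & g2 & Hg).
set (f := psi b (2 * p) (2 * a + d + 2) m) in *.
set (g := psi c (d - b - c) (2 * a + b + d + 3) p) in *.
pose proof (jet2_polar f f1 f2 g g1 g2
  (fun t Ht => proj1 (Hf t Ht)) (fun t Ht => proj1 (proj2 (Hf t Ht)))
  (fun t Ht => proj1 (Hg t Ht)) (fun t Ht => proj1 (proj2 (Hg t Ht)))) as J.
intros x y H.
split; [exact (jet2_has_second_partials_at _ _ _ _ _ _ J x y H)|].
destruct (in_triangle_polar _ _ H) as [Hu Hs].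
destruct (Hf _ Hu) as (_ & _ & Of).
destruct (Hg _ Hs) as (_ & _ & Og).
rewrite (C12_jet2 (Phi a b c d m p) _ _ _ _ _ a b c d x y J H).
rewrite (C123_jet2 (Phi a b c d m p) _ _ _ _ _ a b c d x y J H).
unfold Phi; fold f; fold g; cbv beta.
(* From here on the problem is algebraic: the values of f, g and their derivatives become free
   complex numbers, tied only by the two differential equations [Of] and [Og]. *)
clearbody f g; clear Hf Hg J.
generalize dependent (f (x / (x + y))); intros F0.
generalize dependent (f1 (x / (x + y))); intros F1.
generalize dependent (f2 (x / (x + y))); intros F2 Of.
generalize dependent (g (x + y)); intros G0.
generalize dependent (g1 (x + y)); intros G1.
generalize dependent (g2 (x + y)); intros G2 Og.
assert (Hxy : x + y <> 0) by lra.
assert (Hxy' : (RtoC x + RtoC y <> 0)%C).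
{ intros E; rewrite <- RtoC_plus in E; now apply RtoC_inj in E. }
assert (Ux : RtoC (x / (x + y)) = (RtoC x / (RtoC x + RtoC y))%C).
{ now rewrite RtoC_div, RtoC_plus. }
rewrite Ux in Of; clear Ux.
rewrite RtoC_plus in Og.
push_RtoC.
match type of Of with ?l = ?r => set (Lf := l) in Of; set (Rf := r) in Of end.
match type of Og with ?l = ?r => set (Lg := l) in Og; set (Rg := r) in Og end.
split.
(* [C12] acts on s alone, so its eigenvalue equation is f(u) times the equation of g. *)
- transitivity ((4 * p ^ 2 - 1) / 4 * (F0 * G0) + F0 * (Lg - Rg))%C.
  + subst Lf Rf Lg Rg; clear - Hxy'; field; exact Hxy'.
  + rewrite Og; ring.
(* The radial part of [C123] is u times that of [C12], whence the weight x / (x + y). The term -u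
   p^2 it brings is cancelled by the equation of f, whose parameter gamma is 2p. *)
- transitivity ((4 * m ^ 2 - 1) / 4 * (F0 * G0)
    + x / (x + y) * F0 * (Lg - Rg) + G0 * (Lf - Rf))%C.
  + subst Lf Rf Lg Rg; clear - Hxy'; field; exact Hxy'.
  + rewrite Of, Og; ring.
Qed.
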